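(* Let $F(a,b)$ be the free group of rank two with free basis $\{a,b\}$. Let $m,n,k,\ell$ be integers with $0\le k\le m-2$ and $0\le \ell\le n-1$. Let $H_{k,\ell}^m\le F(a,b)$ be the subgroup $$H_{k,\ell}^m=\big\langle a,\ bab^{-1},\ \ldots,\ b^kab^{-k},\ b^{k+1}a^{n-\ell}b^{-(k+1)},\ b^{k+2}a^nb^{-(k+2)},\ b^{k+3}a^nb^{-(k+3)},\ \ldots,\ b^{m-1}a^nb^{1-m}\big\rangle,$$ and let $K\le F(a,b)$ be the subgroup $$K=\big\langle b,\ aba^{-1},\ \ldots,\ a^{n-1}ba^{1-n}\big\rangle.$$ Then the rank of the free group $H_{k,\ell}^m\cap K$ is $k(n-1)+\ell$.
   Context: The rank of a free group is the cardinality of a free basis (the trivial group has rank $0$); subgroups of free groups are free. The generating set of $H_{k,\ell}^m$ consists of exactly $m$ elements: $b^iab^{-i}$ for $0\le i\le k$; $b^{k+1}a^{n-\ell}b^{-(k+1)}$; and $b^ia^nb^{-i}$ for $k+2\le i\le m-1$ (this last family is empty when $k=m-2$). The generating set of $K$ consists of the elements $a^jba^{-j}$ for $0\le j\le n-1$. The subgroup $H_{k,\ell}^m$ also depends on $n$, which is suppressed from the notation. *)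

(* Defs.v *)
From mathcomp Require Import all_boot.
From mathcomp Require Import monoid.
From mathcomp Require Import boolp classical_sets cardinality.

Set Implicit Arguments.
Unset Strict Implicit.
Unset Printing Implicit Defensive.

Local Open Scope classical_set_scope.
Local Open Scope group_scope.

Section FreeGroups.
Variable F : groupType.
Implicit Types (X G : set F) (w : seq (F * bool)).

Definition generated X : set F :=
  smallest (fun A : set F => group_closed [in A]) X.

(* A word in X and its inverses is a list of letters (x, e) with x in X, where
   (x, false) stands for x and (x, true) for x^-1. *)
Definition word_eval w : F := \prod_(p <- w) (if p.2 then p.1^-1 else p.1).

(* [sorted] only compares adjacent letters, so this says that no letter is
   followed by its formal inverse. *)
Definition reduced w : bool :=
  sorted (fun p q : F * bool => ~~ ((p.1 == q.1) && (p.2 != q.2))) w.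

Definition free_basis X G : Prop :=
  generated X = G /\
  forall w, (forall p, p \in w -> X p.1) -> reduced w -> w <> [::] ->
    word_eval w <> 1.

Definition free_of_rank G (r : nat) : Prop :=
  exists X, free_basis X G /\ (X #= `I_r)%card.

(* For l < n and k + 2 <= m the truncated subtraction n - l is the usual one,
   and the three families have k + 1, 1 and m - k - 2 members. *)
Definition Hgens (a b : F) (m n k l : nat) : set F :=
  [set b ^+ i * a * b ^- i | i in [set i | (i <= k)%N]] `|`
  [set b ^+ k.+1 * a ^+ (n - l) * b ^- k.+1] `|`
  [set b ^+ i * a ^+ n * b ^- i | i in [set i | (k.+2 <= i < m)%N]].

Definition Kgens (a b : F) (n : nat) : set F :=
  [set a ^+ j * b * a ^- j | j in [set j | (j < n)%N]].

Definition subH (a b : F) (m n k l : nat) : set F := generated (Hgens a b m n k l).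

Definition subK (a b : F) (n : nat) : set F := generated (Kgens a b n).

End FreeGroups.

(* Main.v *)
Require Import Defs.
From mathcomp Require Import all_boot.
From mathcomp Require Import monoid zify.
From mathcomp Require Import boolp classical_sets cardinality.

(**
The Stallings graph of H is a b-path with vertices 0, .., m-1 carrying at the
vertex i an a-cycle of length p i (with p i = 1 for i <= k, p (k+1) = n-l, and
p i = n afterwards); that of K is an a-path with n vertices carrying a b-loop
at each vertex.  An element of H `&` K is read by its reduced word in both
graphs, so H `&` K is the fundamental group of the base component of the fibre
product.  There the a-cycle in row i unrolls into n - p i arcs from column j to
column j + p i; those with i > 0 are the edges outside a spanning tree, and they
give the free basis
  a^j b^i a^(p i) b^-i a^-(j + p i)     (0 < i < m, j + p i < n),
which has k(n-1) + l members.

Graphs are encoded as partial injections indexed by the generators, so that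
runs are preserved by free reduction.  Freeness is seen by adding to the states
of the fibre product a reduced word that records the non-tree edges crossed:
a word in a and b that reduces to 1 must restore it.
*)

Set Implicit Arguments.
Unset Strict Implicit.
Unset Printing Implicit Defensive.

Local Open Scope classical_set_scope.

(** * Subgroups generated by a set *)

Section Generated.
Local Open Scope group_scope.
Variable F : groupType.
Implicit Types X A : set F.

Lemma sub_generated X : X `<=` generated X.
Proof. exact: sub_gen_smallest. Qed.

Lemma generated1 X : generated X 1.
Proof. by move=> A [[A1 _] _]; rewrite inE in A1. Qed.

Lemma generated_div X g h : generated X g -> generated X h -> generated X (g / h).
Proof.
move=> Xg Xh A AX; case: (AX) => -[_ Ad] _.
suff : g / h \in A by rewrite inE.
by apply: Ad; rewrite inE; [apply: Xg | apply: Xh].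
Qed.

Lemma generatedV X g : generated X g -> generated X g^-1.
Proof. by move=> Xg; rewrite -div1g; apply: generated_div => //; apply: generated1. Qed.

Lemma generatedM X g h : generated X g -> generated X h -> generated X (g * h).
Proof.
by move=> Xg Xh; rewrite -[h]invgK; apply: generated_div => //; apply: generatedV.
Qed.

Lemma generatedX X g n : generated X g -> generated X (g ^+ n).
Proof.
move=> Xg; elim: n => [|n IHn]; first exact: generated1.
by rewrite expgS; apply: generatedM.
Qed.

Lemma generated_min X A : A 1 -> (forall g h, A g -> A h -> A (g / h)) ->
  X `<=` A -> generated X `<=` A.
Proof.
move=> A1 Ad XA; apply: smallest_sub => //; split; first by rewrite inE.
by move=> g h; rewrite !inE; apply: Ad.
Qed.

End Generated.

(** * Free reduction as an action on reduced words *)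

Section Words.
Variable I : eqType.
Implicit Types (x y : I * bool) (w s : seq (I * bool)).

Definition flip x : I * bool := (x.1, ~~ x.2).

Definition freely_reduced w := sorted (fun x y => y != flip x) w.

(** Left multiplication of a reduced word by the letter [x]; by [pushK] every letter acts as a
    permutation of the reduced words. *)
Definition push x s :=
  if s is y :: s' then if y == flip x then s' else x :: s else [:: x].

Definition inv_word w := rev (map flip w).

Lemma flipK : involutive flip.
Proof. by case=> i e; rewrite /flip /= negbK. Qed.

Lemma flip_sym x y : (y == flip x) = (x == flip y).
Proof. by rewrite -(inj_eq (inv_inj flipK)) flipK eq_sym. Qed.

Lemma push_reduced x s : freely_reduced s -> freely_reduced (push x s).
Proof.
case: s => //= y s; case: eqP => [_|/eqP yx] ys; first exact: path_sorted ys.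
by rewrite /= yx.
Qed.

Lemma pushK x s : freely_reduced s -> push (flip x) (push x s) = s.
Proof.
case: s => [|y s] /=; first by rewrite flipK eqxx.
case: eqP => [->|_] /=; last by rewrite flipK eqxx.
by case: s => [|z s] //= /andP[/negPf ->].
Qed.

Lemma foldr_push_reduced w s : freely_reduced s -> freely_reduced (foldr push s w).
Proof. by move=> rs; elim: w => //= x w; apply: push_reduced. Qed.

Definition nf w := foldr push [::] w.

Lemma nf_reduced w : freely_reduced (nf w).
Proof. exact: foldr_push_reduced. Qed.

Lemma nf_id w : freely_reduced w -> nf w = w.
Proof.
elim: w => //= x w IHw xw; rewrite IHw; last exact: path_sorted xw.
by case: w xw {IHw} => //= y w /andP[/negPf ->].
Qed.

(** A cancelling pair acts trivially by [pushK], so a word acts on reduced words as its normal form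
    does. *)
Lemma foldr_push_nf w s :
  freely_reduced s -> foldr push s w = foldr push s (nf w).
Proof.
move=> rs; elim: w => //= x w ->.
case: (nf w) => //= y w'; case: eqP => //= ->.
by rewrite -{1}[x]flipK pushK // foldr_push_reduced.
Qed.

Lemma foldr_push_inv w s :
  freely_reduced s -> foldr push (foldr push s w) (inv_word w) = s.
Proof.
rewrite /inv_word; elim: w s => //= x w IHw s rs.
by rewrite rev_cons -cats1 foldr_cat /= pushK ?IHw // foldr_push_reduced.
Qed.

Lemma reduced_rev w : freely_reduced w -> freely_reduced (rev w).
Proof.
by rewrite /freely_reduced rev_sorted; apply: sub_sorted => x y; rewrite flip_sym.
Qed.

(** Let [w ++ inv_word w'] act on [nf w']: the right factor brings it to the empty word and [w] then
    to [nf w], yet the whole acts trivially. *)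
Lemma nf_eq w w' : nf (w ++ inv_word w') = [::] -> nf w = nf w'.
Proof.
move=> nf1; have /= := foldr_push_nf (w ++ inv_word w') (nf_reduced w').
by rewrite nf1 foldr_cat foldr_push_inv.
Qed.

End Words.

(** * Runs of words in labelled graphs *)

Section Runs.
Variables (I : eqType) (S : Type) (step : I -> S -> S -> Prop).
Implicit Types (x : I * bool) (w : seq (I * bool)) (s t u : S).

Definition move x s t := if x.2 then step x.1 t s else step x.1 s t.

Fixpoint run s w t :=
  if w is x :: w' then exists2 u, move x s u & run u w' t else s = t.

Lemma move_flip x s t : move (flip x) s t = move x t s.
Proof. by case: x => i []. Qed.

Lemma run_cat s w u w' t : run s w u -> run u w' t -> run s (w ++ w') t.
Proof.
elim: w s => /= [s -> //|x w IHw s [v xv wv] w't].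
by exists v => //; apply: IHw.
Qed.

Lemma run_inv s w t : run s w t -> run t (inv_word w) s.
Proof.
rewrite /inv_word; elim: w s => //= x w IHw s [u xu /IHw wu].
rewrite rev_cons -cats1; apply: (run_cat wu) => /=.
by exists s => //; rewrite move_flip.
Qed.

Lemma run_nseq (f : nat -> S) x q :
  (forall r, (r < q)%N -> move x (f r) (f r.+1)) -> run (f 0%N) (nseq q x) (f q).
Proof.
elim: q f => //= q IHq f fx; exists (f 1%N); first exact: fx.
by apply: (IHq (fun r => f r.+1)) => r rq; apply: fx.
Qed.

(** For each label this is Stallings' condition that the graph is folded. *)
Definition partial_injection (R : S -> S -> Prop) :=
  (forall s t t', R s t -> R s t' -> t = t') /\
  (forall s s' t, R s t -> R s' t -> s = s').

Hypothesis step_pinj : forall i, partial_injection (step i).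

Lemma move_det x s t t' : move x s t -> move x s t' -> t = t'.
Proof. by case: x => i [] /=; have [f g] := step_pinj i; [apply: g | apply: f]. Qed.

(** In a folded graph a letter followed by its inverse returns to the same vertex, so cancelling the
    pair keeps both ends of the run. *)
Lemma run_nf s w t : run s w t -> run s (nf w) t.
Proof.
elim: w s => //= x w IHw s [u xu /IHw].
case: (nf w) => [|y w'] /=; first by move=> <-; exists u.
case: eqP => [-> [v]|_ [v yv wv]]; last by exists u => //; exists v.
by rewrite move_flip => /= xv; rewrite (move_det (x := flip x) (s:=u) (t := s) (t' := v)) ?move_flip.
Qed.

End Runs.

(** * Evaluation of words and free families *)

Section Evaluation.
Local Open Scope group_scope.
Variable F : groupType.

Definition eval (I : eqType) (phi : I -> F) (w : seq (I * bool)) : F :=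
  word_eval [seq (phi x.1, x.2) | x <- w].

(** Words are taken over the indices, so a repeated value on [D] would itself be a relation;
    injectivity on [D] follows. *)
Definition free_family (I : eqType) (phi : I -> F) (D : set I) :=
  forall v, (forall x, x \in v -> D x.1) -> freely_reduced v ->
    eval phi v = 1 -> v = [::].

Section One.
Variables (I : eqType) (phi : I -> F).
Implicit Types (x : I * bool) (w : seq (I * bool)).

Lemma eval_nil : eval phi [::] = 1.
Proof. by rewrite /eval /word_eval big_nil. Qed.

Lemma eval_cons x w :
  eval phi (x :: w) = (if x.2 then (phi x.1)^-1 else phi x.1) * eval phi w.
Proof. by rewrite /eval /word_eval /= big_cons. Qed.

Lemma eval_cat w w' : eval phi (w ++ w') = eval phi w * eval phi w'.
Proof. by rewrite /eval /word_eval map_cat big_cat. Qed.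

Lemma eval_flip x : eval phi [:: flip x] = (eval phi [:: x])^-1.
Proof. by rewrite !eval_cons !eval_nil !mulg1; case: x => i [] /=; rewrite ?invgK. Qed.

Lemma eval_inv w : eval phi (inv_word w) = (eval phi w)^-1.
Proof.
rewrite /inv_word; elim: w => [|x w IHw] /=; first by rewrite eval_nil invg1.
by rewrite rev_cons -cats1 eval_cat IHw eval_flip -(cat1s x w) eval_cat invgM.
Qed.

Lemma eval_nseq x q : eval phi (nseq q x) = eval phi [:: x] ^+ q.
Proof.
elim: q => [|q IHq]; first by rewrite eval_nil expg0.
by rewrite -[nseq q.+1 x]/([:: x] ++ nseq q x) eval_cat IHq expgS.
Qed.

Lemma eval_nf w : eval phi (nf w) = eval phi w.
Proof.
elim: w => //= x w IHw; rewrite eval_cons -IHw.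
case: (nf w) => [|y s] /=; first by rewrite eval_cons.
case: eqP => [->|_]; last by rewrite eval_cons.
by rewrite eval_cons mulgA; case: x => i [] /=; rewrite ?mulVg ?mulgV mul1g.
Qed.

Lemma free_nf_eq w w' : free_family phi setT ->
  eval phi w = eval phi w' -> nf w = nf w'.
Proof.
move=> free eq_ww'; apply/nf_eq/free => //; first exact: nf_reduced.
by rewrite eval_nf eval_cat eval_inv eq_ww' mulgV.
Qed.

Lemma free_family_inj (D : set I) :
  free_family phi D -> {in D &, injective phi}.
Proof.
move=> free i j; rewrite !inE => Di Dj eq_ij; apply: contrapT => /eqP nij.
suff: [:: (i, false); (j, true)] = [::] by [].
apply: free => [x|/=|]; first by rewrite !inE => /orP[]/eqP->.
  by rewrite andbT xpair_eqE negb_and eq_sym nij.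
by rewrite !eval_cons eval_nil /= eq_ij mulg1 mulgV.
Qed.

Lemma free_family_basis (D : set I) :
  free_family phi D -> free_basis (phi @` D) (generated (phi @` D)).
Proof.
move=> free; split=> // w wX rw w0 ew; apply: w0.
have [v vD wv] : exists2 v, (forall x, x \in v -> D x.1) &
    w = [seq (phi x.1, x.2) | x <- v].
  elim: w wX {rw ew} => [|[g e] w IHw] wX; first by exists [::].
  have [i Di phii] := wX (g, e) (mem_head _ _).
  have [|v vD ->] := IHw; first by move=> p pw; apply: wX; rewrite inE pw orbT.
  exists ((i, e) :: v) => [x|/=]; last by rewrite phii.
  by rewrite inE => /orP[/eqP->|/vD].
rewrite wv in rw ew *; rewrite (free v) //.
move: rw; rewrite /reduced sorted_map; apply: sub_sorted => x y /=.
apply: contra => /eqP -> /=; rewrite eqxx /=; by case: x.2.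
Qed.

End One.

(** As [a] and [b] differ, letters that cancel in [F] already cancel as indices. *)
Lemma free_basis_pair (a b : F) : a <> b -> free_basis [set a; b] [set: F] ->
  free_family (fun c : bool => if c then b else a) setT.
Proof.
move=> /eqP nab [_ free] v _ rv ev; apply: contrapT => v0.
apply: (free _ _ _ _ ev); last by case: (v) v0.
  by move=> q /mapP[[[] e] _ ->]; [right | left].
rewrite /reduced sorted_map; apply: sub_sorted rv => -[c e] [c' e'] /=.
apply: contra => /andP[cc' ee']; rewrite /flip xpair_eqE /=; apply/andP; split.
  by case: c c' cc' => [] [] //; rewrite ?[b == a]eq_sym (negPf nab).
by case: e e' ee' => [] [].
Qed.

Section Loops.
Variables (I : eqType) (phi : I -> F) (S : Type) (step : I -> S -> S -> Prop).

(** The labels of loops at [s] form a subgroup: loops are concatenated, and reversed for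
    inverses. *)
Lemma generated_loops (X : set F) (s : S) :
  (forall g, X g -> exists2 w, run step s w s & eval phi w = g) ->
  forall g, generated X g -> exists2 w, run step s w s & eval phi w = g.
Proof.
move=> XL; apply: generated_min => //.
  by exists [::]; rewrite ?eval_nil.
move=> _ _ [w ws <-] [w' w's <-]; exists (w ++ inv_word w').
  by apply: run_cat ws _; apply: run_inv.
by rewrite eval_cat eval_inv.
Qed.

End Loops.

End Evaluation.

(** * The fibre product of the two graphs *)

Section Intersection.
Local Open Scope group_scope.
Variables (F : groupType) (a b : F) (m n : nat) (p : nat -> nat).

Definition gen (c : bool) : F := if c then b else a.

Hypothesis gen_free : free_family gen setT.
Hypothesis m_gt0 : (0 < m)%N.
Hypotheses (p_gt0 : forall i, (0 < p i)%N) (p0 : p 0 = 1%N).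

Let A : bool * bool := (false, false).
Let B : bool * bool := (true, false).

Definition rowgens : set F := [set b ^+ i * a ^+ p i * b ^- i | i in [set i | (i < m)%N]].

(** The arcs outside the tree, row first: [(i, j)] is the arc in row [i] from column [j] to column
    [j + p i]. *)
Definition cell : set (nat * nat) := [set d | (0 < d.1 < m)%N /\ (d.2 + p d.1 < n)%N].

Definition cell_elt (d : nat * nat) : F :=
  a ^+ d.2 * b ^+ d.1 * a ^+ p d.1 * (a ^+ (d.2 + p d.1) * b ^+ d.1)^-1.

(* The state (i, t) is the t-th vertex of the a-cycle attached at the vertex i. *)
Definition hstep (c : bool) (s s' : nat * nat) : Prop :=
  if c then [/\ s.2 = 0, s'.2 = 0, s'.1 = s.1.+1 & s'.1 < m]%N
  else [/\ s'.1 = s.1, s.1 < m &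
    s.2.+1 < p s.1 /\ s'.2 = s.2.+1 \/ s.2.+1 = p s.1 /\ s'.2 = 0]%N.

Definition kstep (c : bool) (j j' : nat) : Prop :=
  if c then j' = j else j' = j.+1 /\ (j' < n)%N.

Lemma hstep_pinj c : partial_injection (hstep c).
Proof.
case: c; split=> -[i t] [i1 t1] [i2 t2] [/=].
- by move=> -> -> -> _ [/= _ -> ->].
- by move=> -> -> -> _ [/= -> _ []->].
- by move=> -> _ tE [/= -> _ tE2]; congr (_, _); lia.
- by move=> -> _ tE [/= iE _]; rewrite -iE => tE2; congr (_, _); lia.
Qed.

Lemma kstep_pinj c : partial_injection (kstep c).
Proof. by case: c; split=> j j1 j2 /=; lia. Qed.

(* The wrap-around edge of an a-cycle at column j is a tree edge exactly when the
   arc containing it starts to the left of column 0 or lies in row 0. *)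
Definition emits (c : bool) (s : nat * nat) (j : nat) : bool :=
  [&& ~~ c, 0 < s.1, s.2.+1 == p s.1 & s.2 <= j]%N.

Definition state : Type := nat * nat * nat * seq ((nat * nat) * bool).

(** The recorded word is required to be reduced so that [push] can be undone, which makes the step
    injective. *)
Definition zstep (c : bool) (q q' : state) : Prop :=
  [/\ hstep c q.1.1 q'.1.1, kstep c q.1.2 q'.1.2, freely_reduced q.2 &
    q'.2 = if emits c q.1.1 q.1.2 then push (q.1.1.1, q.1.2 - q.1.1.2, false)%N q.2
           else q.2].

Lemma zstep_pinj c : partial_injection (zstep c).
Proof.
have [hf hi] := hstep_pinj c; have [kf ki] := kstep_pinj c.
split=> -[[s j] z] [[s1 j1] z1] [[s2 j2] z2] [/= hs ks rz zE] [/= hs' ks' rz' zE'].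
  by rewrite (hf _ _ _ hs hs') (kf _ _ _ ks ks') zE zE'.
move: zE; rewrite zE' (hi _ _ _ hs hs') (ki _ _ _ ks ks').
case: emits => [zE|-> //].
by rewrite -(pushK (s1.1, j1 - s1.2, false)%N rz) -zE pushK.
Qed.

(** * Freeness of the cell elements *)

Lemma zrun_position i j z : freely_reduced z -> (i < m)%N -> (j < n)%N ->
  run zstep ((0, 0), 0, z)%N (nseq j A ++ nseq i B) ((i, 0), j, z)%N.
Proof.
(* Row 0 and all [b]-edges lie in the tree, so nothing is recorded. *)
move=> rz im jn; apply: (@run_cat _ _ _ _ _ ((0, 0), j, z)%N).
  by apply: (run_nseq (f := fun r => ((0, 0), r, z)%N)) => r rj; split=> //=;
    split=> //=; lia.
apply: (run_nseq (f := fun r => ((r, 0), j, z)%N)) => r ri; split=> //=.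
by split=> //=; lia.
Qed.

Lemma nseq_period i : nseq (p i) A = nseq (p i).-1 A ++ [:: A].
Proof. by have pi0 := p_gt0 i; rewrite -(nseqD _ 1%N); congr nseq; lia. Qed.

Lemma zrun_row i j z : freely_reduced z -> cell (i, j) ->
  run zstep ((i, 0), j, z)%N (nseq (p i) A) ((i, 0), j + p i, push (i, j, false) z)%N.
Proof.
move=> rz [/= /andP[i0 im] jn]; have pi0 := p_gt0 i.
rewrite nseq_period.
apply: (@run_cat _ _ _ _ _ ((i, (p i).-1), j + (p i).-1, z)%N).
  have := @run_nseq _ _ zstep (fun r => ((i, r), j + r, z)%N) A (p i).-1.
  rewrite addn0; apply=> r ri; split=> //=; first by split=> //=; lia.
    by lia.
  by rewrite /emits /= (_ : _ == _ = false) ?andbF //; lia.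
(* The wrap-around edge leaves position [p i - 1] in column [j + p i - 1], so the recorded arc
   starts in column [j]. *)
exists ((i, 0), j + p i, push (i, j, false) z)%N => //; split=> //=.
- by split=> //=; lia.
- by lia.
- by rewrite /emits /= i0 /= (_ : _ && _ = true) ?addnK //; lia.
Qed.

Definition cell_word (d : nat * nat) : seq (bool * bool) :=
  (nseq d.2 A ++ nseq d.1 B) ++ nseq (p d.1) A ++
  inv_word (nseq (d.2 + p d.1) A ++ nseq d.1 B).

Lemma eval_nseqA q : eval gen (nseq q A) = a ^+ q.
Proof. by rewrite eval_nseq eval_cons eval_nil mulg1. Qed.

Lemma eval_nseqB q : eval gen (nseq q B) = b ^+ q.
Proof. by rewrite eval_nseq eval_cons eval_nil mulg1. Qed.

Lemma eval_cell_word d : eval gen (cell_word d) = cell_elt d.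
Proof. by rewrite !(eval_cat, eval_inv, eval_nseqA, eval_nseqB) mulgA. Qed.

Lemma zrun_cell_word d z : freely_reduced z -> cell d ->
  run zstep ((0, 0), 0, z)%N (cell_word d) ((0, 0), 0, push (d, false) z)%N.
Proof.
case: d => i j rz Dij; have [/= /andP[i0 im] jn] := Dij.
have jn' : (j < n)%N by lia.
apply: run_cat (zrun_position rz im jn') _.
apply: run_cat (zrun_row rz Dij) _; apply/run_inv/zrun_position => //.
exact: push_reduced.
Qed.

Definition cell_letter (x : (nat * nat) * bool) : seq (bool * bool) :=
  if x.2 then inv_word (cell_word x.1) else cell_word x.1.

Lemma zrun_cell_letter x z : freely_reduced z -> cell x.1 ->
  run zstep ((0, 0), 0, z)%N (cell_letter x) ((0, 0), 0, push x z)%N.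
Proof.
case: x => d [] rz Dd; last exact: zrun_cell_word.
(* Reverse the run of [cell_word d] that leads from [push (d, true) z] to [z]. *)
apply: run_inv; rewrite -{2}[z](pushK (d, true)) //.
by apply: zrun_cell_word => //; apply: push_reduced.
Qed.

Lemma zrun_cells v z : freely_reduced z -> (forall x, x \in v -> cell x.1) ->
  run zstep ((0, 0), 0, z)%N (flatten (map cell_letter v))
    ((0, 0), 0, foldl (fun z x => push x z) z v)%N.
Proof.
elim: v z => //= x v IHv z rz vD.
apply: run_cat (zrun_cell_letter rz (vD x _)) (IHv _ _ _); rewrite ?mem_head //.
  exact: push_reduced.
by move=> y yv; apply: vD; rewrite inE yv orbT.
Qed.

Lemma eval_cells v : eval gen (flatten (map cell_letter v)) = eval cell_elt v.
Proof.
elim: v => [|[d e] v IHv]; first by rewrite !eval_nil.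
rewrite /= eval_cat eval_cons IHv; congr (_ * _).
by case: e; rewrite /cell_letter /= ?eval_inv eval_cell_word.
Qed.

(** If [v] evaluates to 1, its word in [a] and [b] reduces to the empty word, whose run leaves the
    empty record unchanged. The record reached is [rev v], because later letters are pushed in
    front. *)
Lemma cell_elt_free : free_family cell_elt cell.
Proof.
move=> v vD rv ev; have := zrun_cells (z := [::]) isT vD.
move=> /(run_nf zstep_pinj); rewrite (gen_free _ (nf_reduced _)) //; last first.
  by rewrite eval_nf eval_cells.
rewrite -[v in foldl _ _ v]revK foldl_rev => -[].
by rewrite -/(nf (rev v)) nf_id ?reduced_rev // => /(congr1 rev); rewrite revK.
Qed.

(** * Generation of the intersection *)

Lemma generated_conjX (X : set F) (g h : F) q :
  generated X (g * h * g^-1) -> generated X (g * h ^+ q * g^-1).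
Proof.
move=> Xgh; elim: q => [|q IHq].
  by rewrite expg0 mulg1 mulgV; apply: generated1.
suff -> : g * h ^+ q.+1 * g^-1 = (g * h * g^-1) * (g * h ^+ q * g^-1).
  exact: generatedM.
by rewrite expgS !mulgA mulgVK.
Qed.

(** Bracketing [b^i a^(p i) b^-i] shows membership in H. For K, the element is the quotient of the
    conjugates of [b^i] by [a^j] and [a^(j + p i)]. *)
Lemma cell_elt_sub :
  cell_elt @` cell `<=` generated rowgens `&` generated (Kgens a b n).
Proof.
move=> _ [[i j] [/= /andP[i0 im] jn] <-]; rewrite /cell_elt /=; split.
  have aH : generated rowgens a.
    by apply: sub_generated; exists 0%N; rewrite //= p0 expg0 invg1 mul1g mulg1 expg1.
  have iH : generated rowgens (b ^+ i * a ^+ p i * b ^- i).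
    by apply: sub_generated; exists i.
  have -> : a ^+ j * b ^+ i * a ^+ p i * (a ^+ (j + p i) * b ^+ i)^-1 =
            a ^+ j * (b ^+ i * a ^+ p i * b ^- i) / a ^+ (j + p i).
    by rewrite invgM !mulgA.
  apply: generated_div; last exact: generatedX.
  by apply: generatedM => //; apply: generatedX.
have jK j' : (j' < n)%N -> generated (Kgens a b n) (a ^+ j' * b ^+ i * a ^- j').
  by move=> j'n; apply: generated_conjX; apply: sub_generated; exists j'.
have jn' : (j < n)%N by lia.
have := generated_div (jK j jn') (jK (j + p i)%N jn).
rewrite !invgM invgK !mulgA; congr (generated _ (_ * _ * _)).
by rewrite expgnDr mulgA mulgVK.
Qed.

(* The tree path from the base vertex: the vertex is entered from the start of its
   arc, or from the end if the arc would start to the left of column 0. *)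
Definition label (s : nat * nat) (j : nat) : F :=
  if (s.2 <= j)%N then a ^+ (j - s.2) * b ^+ s.1 * a ^+ s.2
  else a ^+ (j + p s.1 - s.2) * b ^+ s.1 * a ^- (p s.1 - s.2).

(** A tree edge contributes 1, and the wrap-around edge of a cell contributes its cell element. *)
Lemma label_step c s s' j j' : hstep c s s' -> kstep c j j' ->
  generated (cell_elt @` cell) (label s j * gen c * (label s' j')^-1).
Proof.
have tree g g' : g = g' -> generated (cell_elt @` cell) (g / g').
  by move=> ->; rewrite mulgV; apply: generated1.
case: s s' => [i t] [i' t']; case: c => /= [[/= -> -> -> _] ->|].
  by apply: tree; rewrite /label /= !expg0 !mulg1 subn0 -mulgA -expgSr.
case=> /= -> im tE [-> jn]; rewrite /label /= /gen.
case: tE => -[tp ->].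
  apply: tree; rewrite ltnS; case: leqP => tj; first by rewrite subSS -mulgA -expgSr.
  have -> : (p i - t = (p i - t.+1).+1)%N by lia.
  by rewrite (expgS a (p i - t.+1)) invgM mulgA mulgVK; congr (a ^+ _ * _ * _); lia.
(* The wrap-around edge: for [t > j] the arc starts left of column 0 and the edge belongs to the
   tree. *)
rewrite leq0n subn0 expg0 mulg1; case: leqP => tj; last first.
  by apply: tree; rewrite -tp (_ : t.+1 - t = 1)%N ?expg1 ?mulgVK; [congr (a ^+ _ * _)|]; lia.
rewrite -[X in X / _]mulgA -expgSr tp.
have -> : (j.+1 = (j - t) + p i)%N by lia.
have [i0|i0] := posnP i.
  by apply: tree; rewrite i0 !expg0 !mulg1 expgnDr.
(* The arc starts in column [j - t] and ends in column [j + 1 < n]. *)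
by apply: sub_generated; exists (i, j - t)%N => //; split=> /=; lia.
Qed.

(** The labels of intermediate vertices cancel in the product over the steps. *)
Lemma label_run w s s' j j' : run hstep s w s' -> run kstep j w j' ->
  generated (cell_elt @` cell) (label s j * eval gen w * (label s' j')^-1).
Proof.
elim: w s j => /= [s j -> ->|[c e] w IHw s j [s1 hx hw] [j1 kx kw]].
  by rewrite eval_nil mulg1 mulgV; apply: generated1.
have first_move : generated (cell_elt @` cell)
    (label s j * (if e then (gen c)^-1 else gen c) * (label s1 j1)^-1).
  case: e hx kx => /= hx kx; last exact: label_step.
  by have := generatedV (label_step hx kx); rewrite !invgM invgK mulgA.
by have := generatedM first_move (IHw _ _ hw kw); rewrite eval_cons !mulgA mulgVK.
Qed.

Lemma rowgens_loop g :
  rowgens g -> exists2 w, run hstep (0, 0)%N w (0, 0)%N & eval gen w = g.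
Proof.
move=> [i /= im <-]; exists (nseq i B ++ nseq (p i) A ++ inv_word (nseq i B)).
  have up : run hstep (0, 0)%N (nseq i B) (i, 0)%N.
    by apply: (run_nseq (f := fun r => (r, 0)%N)) => r ri; split=> //=; lia.
  apply: (run_cat up); apply: (run_cat _ (run_inv up)); have pi0 := p_gt0 i.
  rewrite nseq_period.
  apply: (@run_cat _ _ _ _ _ (i, (p i).-1)%N).
    by apply: (run_nseq (f := fun r => (i, r)%N)) => r ri; split=> //=; lia.
  by exists (i, 0)%N => //; split=> //=; lia.
by rewrite !(eval_cat, eval_inv, eval_nseqA, eval_nseqB) mulgA.
Qed.

Lemma Kgens_loop g :
  Kgens a b n g -> exists2 w, run kstep 0%N w 0%N & eval gen w = g.
Proof.
move=> [j /= jn <-]; exists (nseq j A ++ [:: B] ++ inv_word (nseq j A)).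
  have right : run kstep 0%N (nseq j A) j.
    by apply: (run_nseq (f := fun r => r)) => r rj; split=> //=; lia.
  apply: (run_cat right); apply: (run_cat _ (run_inv right)).
  by exists j.
by rewrite !(eval_cat, eval_inv, eval_nseqA, eval_cons, eval_nil) mulg1 mulgA.
Qed.

Lemma generated_cell_elt :
  generated (cell_elt @` cell) = generated rowgens `&` generated (Kgens a b n).
Proof.
rewrite eqEsubset; split.
  apply: generated_min; last exact: cell_elt_sub.
    by split; apply: generated1.
  by move=> g h [? ?] [? ?]; split; apply: generated_div.
move=> g [/(generated_loops rowgens_loop)[w hw wg] /(generated_loops Kgens_loop)[w' kw' w'g]].
(* The loops in the two graphs may spell different words; freeness gives a common normal form that
   runs in both. *)
have /(free_nf_eq gen_free) eq_nf : eval gen w = eval gen w' by rewrite w'g.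
have kw : run kstep 0%N (nf w) 0%N by rewrite eq_nf; apply: run_nf kstep_pinj _ _ _ kw'.
have := label_run (run_nf hstep_pinj hw) kw.
by rewrite eval_nf wg /label /= !expg0 !mulg1 invg1 mulg1 mul1g.
Qed.

Lemma free_basis_cell_elt :
  free_basis (cell_elt @` cell) (generated rowgens `&` generated (Kgens a b n)).
Proof. by rewrite -generated_cell_elt; apply: free_family_basis; apply: cell_elt_free. Qed.

End Intersection.

(** * Counting the cells *)

Section Rows.
Variables (m n k l : nat).
Hypotheses (km : (k + 2 <= m)%N) (ln : (l + 1 <= n)%N).

Definition period (i : nat) : nat :=
  if (i <= k)%N then 1 else if i == k.+1 then n - l else n.

Lemma Hgens_rowgens (F : groupType) (a b : F) :
  Hgens a b m n k l = rowgens a b m period.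
Proof.
rewrite eqEsubset; split=> [_ [[[i /= ik <-]|->]|[i /= /andP[ki im] <-]]|_ [i /= im <-]].
- by exists i => /=; [lia|rewrite /period ik expg1].
- by exists k.+1 => /=; [lia|rewrite /period ltnn eqxx].
- by exists i => //=; rewrite /period !ifF //; lia.
rewrite /period; case: leqP => ik; first by left; left; exists i.
case: eqP => [->|ik1]; first by left; right.
by right; exists i => //=; lia.
Qed.

(** Rows 1 to [k] hold [n - 1] cells each, row [k + 1] holds [l], and later rows none; division by
    [n - 1] enumerates them row by row. *)
Lemma card_cell : (cell m n period #= `I_(k * (n - 1) + l))%card.
Proof.
pose f r := ((r %/ (n - 1)).+1, r %% (n - 1))%N.
have -> : cell m n period = f @` `I_(k * (n - 1) + l).
  rewrite eqEsubset; split=> [[i j] [/= /andP[i0 im] jn]|_ [r /= rk <-]].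
    have jn1 : (j < n - 1)%N by move: jn; rewrite /period; case: ifP; [|case: ifP]; lia.
    exists (i.-1 * (n - 1) + j)%N => /=; last first.
      rewrite /f divnMDl; last by lia.
      by rewrite modnMDl modn_small // divn_small // addn0 prednK.
    move: jn; rewrite /period /=; case: (leqP i k) => ik jn.
      have : (i.-1.+1 * (n - 1) <= k * (n - 1))%N by rewrite leq_mul2r; lia.
      by rewrite mulSn; lia.
    by case: eqP jn => [->|]; lia.
  (* For [n = 1] also [l = 0], and there would be no index [r]. *)
  have n1 : (0 < n - 1)%N by lia.
  have rE := divn_eq r (n - 1); have rlt := ltn_pmod r n1.
  have qk : (r %/ (n - 1) <= k)%N by rewrite -ltnS ltn_divLR //; lia.
  split=> /=; first by lia.
  rewrite /period; case: (ltnP (r %/ (n - 1)) k) => kq; first by lia.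
  have qE : (r %/ (n - 1) = k)%N by lia.
  by rewrite qE eqxx; rewrite qE in rE; lia.
apply: inj_card_eq => r s _ _ [qE rE].
by rewrite (divn_eq r (n - 1)) qE rE -divn_eq.
Qed.

End Rows.

Theorem mainTheorem1 (F : groupType) (a b : F)
    (hab : a <> b) (hF : free_basis [set a; b] [set: F])
    (m n k l : nat) (hk : k + 2 <= m) (hl : l + 1 <= n) :
  free_of_rank (subH a b m n k l `&` subK a b n) (k * (n - 1) + l).
Proof.
have free := free_basis_pair hab hF.
have p_gt0 i : (0 < period n k l i)%N.
  by rewrite /period; case: ifP => // _; case: ifP; lia.
have m_gt0 : (0 < m)%N by lia.
exists (cell_elt a b (period n k l) @` cell m n (period n k l)); split.
  by rewrite /subH Hgens_rowgens //; apply: free_basis_cell_elt.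
apply: card_eq_trans (card_cell hk hl); apply: inj_card_eq.
by apply: free_family_inj; apply: cell_elt_free.
Qed.
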